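(* Let $d\ge1$, $0\le n\le m\le N$ be integers and $\kappa\in\mathbb R^{d+1}$ with all $\kappa_i>-1$. For $\alpha\in\mathbb Z_m^{d+1}$ and $x\in\mathbb Z_N^{d+1}$, $$\mathsf Q_{\alpha,n}(x;\kappa,N)=\frac{(-1)^m(-N)_m(-m)_n(|\kappa|+d+1)_n(|\kappa|+d+2n)}{n!\,(|\kappa|+d+1)_{m+n}(|\kappa|+d+n)}\sum_{k=0}^n\frac{(-n)_k(|\kappa|+d+n)_k}{(-m)_k(-N)_k}\,\mathcal E_k(\alpha,x;\kappa),$$ where the ratio $\frac{|\kappa|+d+2n}{|\kappa|+d+n}$ is read as $1$ when $n=0$.
   Context: Notation: $(a)_n=a(a+1)\cdots(a+n-1)$, $(a)_0=1$; for vectors, $|y|$ is the sum of the components, $\alpha!=\prod_i\alpha_i!$, $(y)_\alpha=\prod_i(y_i)_{\alpha_i}$; $\mathbf 1=(1,\dots,1)$. $\mathbb Z_N^{d+1}=\{\alpha\in\mathbb N_0^{d+1}:|\alpha|=N\}$. Inner product: $\langle f,g\rangle_{\mathsf H_{\kappa,N}}=\frac{N!}{(|\kappa|+d+1)_N}\sum_{x\in\mathbb Z_N^{d+1}}f(x)g(x)\frac{(\kappa+\mathbf 1)_x}{x!}$. $\Pi_n^d$ is the space of polynomials of total degree at most $n$ in $x_1,\dots,x_d$ ($\Pi_{-1}^d=\{0\}$), regarded as functions on $\mathbb Z_N^{d+1}$ (where $x_{d+1}=N-x_1-\cdots-x_d$); polynomials in $x_1,\dots,x_{d+1}$ are regarded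 as functions on $\mathbb Z_N^{d+1}$ in the same way. For $0\le n\le N$, $\mathcal V_n^d(\mathsf H_{\kappa,N})$ is the space of $p\in\Pi_n^d$ orthogonal to $\Pi_{n-1}^d$. Let $\mathrm m_\alpha(x)=(-1)^{|\alpha|}(-x)_\alpha$, and for $n\le|\alpha|\le N$ let $\mathsf Q_{\alpha,n}(\cdot;\kappa,N)=\frac{1}{(\kappa+\mathbf 1)_\alpha}\mathrm{proj}_{\mathcal V_n^d(\mathsf H_{\kappa,N})}\mathrm m_\alpha$, with $\mathrm{proj}$ the orthogonal projection of $\Pi_N^d$ onto $\mathcal V_n^d(\mathsf H_{\kappa,N})$. Further, $\mathcal E_0(x,y;\kappa)=1$ and $\mathcal E_k(x,y;\kappa)=\sum_{\gamma\in\mathbb N_0^{d+1},|\gamma|=k}\frac{(-x)_\gamma(-y)_\gamma}{\gamma!\,(\kappa+\mathbf 1)_\gamma}$ for $k\ge1$. *)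

(* Defs.v *)
From HB Require Import structures.
From mathcomp Require Import all_boot all_order all_algebra.
From mathcomp Require Export mpoly.

Set Implicit Arguments.
Unset Strict Implicit.
Unset Printing Implicit Defensive.

Import Order.TTheory GRing.Theory Num.Theory.
Local Open Scope ring_scope.

(* Z_N^{d+1}, as a finite type. *)
Record simplex (d N : nat) := Simplex {
  simplex_val :> 'X_{1..d.+1 < N.+1};
  _ : mdeg simplex_val == N
}.

HB.instance Definition _ d N := [isSub for @simplex_val d N].
HB.instance Definition _ d N := [Finite of simplex d N by <:].

Definition mfact (D : nat) (g : 'X_{1..D}) : nat := (\prod_(i < D) (g i)`!)%N.

Section Pochhammer.
Variable R : realFieldType.

Definition poch (a : R) (n : nat) : R := \prod_(i < n) (a + i%:R).

Definition pochv (D : nat) (a : 'I_D -> R) (g : 'X_{1..D}) : R :=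
  \prod_(i < D) poch (a i) (g i).

Definition shift1 (D : nat) (kappa : 'I_D -> R) : 'I_D -> R :=
  fun i => kappa i + 1.

Definition natpt (D : nat) (x : 'X_{1..D}) : 'I_D -> R := fun i => (x i)%:R.

Definition oppv (D : nat) (x : 'I_D -> R) : 'I_D -> R := fun i => - x i.

Definition E_ (d k : nat) (x y kappa : 'I_d.+1 -> R) : R :=
  if k == 0%N then 1 else
  \sum_(g : simplex d k)
    (pochv (oppv x) g * pochv (oppv y) g)
      / ((mfact g)%:R * pochv (shift1 kappa) g).

End Pochhammer.

Section Hahn.
Variables (R : realFieldType) (d N : nat).

Local Notation fsp := {ffun simplex d N -> R^o}.

(* Restriction to Z_N^{d+1} of a polynomial in the first d coordinates. *)
Definition poly_fun (p : {mpoly R[d]}) : fsp :=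
  [ffun x : simplex d N => p.@[fun i : 'I_d => (x (widen_ord (leqnSn d) i))%:R]].

(* The functions given by polynomials of total degree < k: Pi_n^d is
   [polysp n.+1], and Pi_{n-1}^d is [polysp n] also when n = 0. *)
Definition polysp (k : nat) : {vspace fsp} :=
  <<[seq poly_fun 'X_[b] | b : 'X_{1..d < k}]>>%VS.

Lemma poly_fun_is_linear : linear poly_fun.
Proof. by move=> a p q; apply/ffunP=> x; rewrite !ffunE mevalD mevalZ. Qed.

HB.instance Definition _ :=
  GRing.isLinear.Build R {mpoly R[d]} fsp _ poly_fun poly_fun_is_linear.

Lemma polyspP (k : nat) (f : fsp) :
  reflect (exists2 p : {mpoly R[d]}, (msize p <= k)%N & f = poly_fun p)
          (f \in polysp k).
Proof.
apply: (iffP idP) => [|[p le_pk ->]]; last first.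
  rewrite [p](mpolywE le_pk) raddf_sum /= memv_suml // => b _.
  rewrite linearZ memvZ // memv_span //.
  exact: (image_f (fun b : 'X_{1..d < k} => poly_fun 'X_[b])).
move=> /(@coord_span _ _ _ (in_tuple _)) ->.
set s := in_tuple _; set c := coord s.
have Ps (i : 'I_(size s)) : exists b : 'X_{1..d < k}, s`_i = poly_fun 'X_[b].
  by have /mapP[b _ ->] := mem_nth 0 (ltn_ord i); exists b.
have [b Eb] := fin_all_exists Ps.
exists (\sum_(i < size s) c i f *: 'X_[b i]).
  elim/big_ind: _ => [|p q lep leq|i _]; first by rewrite msize0.
    by apply: leq_trans (msizeD_le _ _) _; rewrite geq_max lep.
  by apply: leq_trans (msizeZ_le _ _) _; rewrite msizeX bmdeg.
by rewrite raddf_sum; apply: eq_bigr => i _; rewrite Eb -linearZ.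
Qed.

Variable kappa : 'I_d.+1 -> R.

Definition ksum : R := \sum_(i < d.+1) kappa i.

Definition hahn_dot (f g : fsp) : R :=
  (N`!)%:R / poch (ksum + d.+1%:R) N
    * \sum_(x : simplex d N)
        f x * g x * (pochv (shift1 kappa) x / (mfact x)%:R).

Lemma hahn_dotC f g : hahn_dot f g = hahn_dot g f.
Proof.
by congr (_ * _); apply: eq_bigr => x _; rewrite [f x * g x]mulrC.
Qed.

Lemma hahn_dotPl f : scalar (hahn_dot^~ f).
Proof.
move=> a u v; rewrite /hahn_dot mulrCA -mulrDr; congr (_ * _).
rewrite mulr_sumr -big_split; apply: eq_bigr => x _ /=.
by rewrite !ffunE /= !mulrDl !mulrA.
Qed.

Lemma hahn_dot_bilinear :
  bilinear_for (GRing.Scale.Law.clone _ _ *%R _)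
    (GRing.Scale.Law.clone _ _ (idfun \; *%R) _) hahn_dot.
Proof.
split=> [f|f] a u v /=; first exact: hahn_dotPl.
by rewrite ![hahn_dot f _]hahn_dotC hahn_dotPl.
Qed.

HB.instance Definition _ :=
  bilinear_isBilinear.Build R fsp fsp R _ _ hahn_dot hahn_dot_bilinear.

Lemma hahn_dot_herm f g : hahn_dot f g = (-1) ^+ false * idfun (hahn_dot g f).
Proof. by rewrite mul1r /= hahn_dotC. Qed.

HB.instance Definition _ :=
  isHermitianSesquilinear.Build R fsp false idfun hahn_dot hahn_dot_herm.

(* V_n^d(H_{kappa,N}) *)
Definition Vsp (n : nat) : {vspace fsp} :=
  (polysp n.+1 :&: orthov hahn_dot (polysp n))%VS.

(* The orthogonal projection of Pi_N^d onto V_n^d: the projection onto V_n^d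
   along the orthogonal complement of V_n^d in Pi_N^d. *)
Definition projV (n : nat) : 'End(fsp) :=
  daddv_pi (Vsp n) (polysp N.+1 :&: orthov hahn_dot (Vsp n)).

Definition mono (alpha : 'X_{1..d.+1}) : fsp :=
  [ffun x : simplex d N => (-1) ^+ mdeg alpha * pochv (oppv (natpt R x)) alpha].

Definition Q_ (alpha : 'X_{1..d.+1}) (n : nat) : fsp :=
  (pochv (shift1 kappa) alpha)^-1 *: projV n (mono alpha).

End Hahn.

(* Main.v *)
Require Import Defs.
From mathcomp Require Import all_boot all_order all_algebra.
From mathcomp Require Import ring zify.

(* Write c = kappa + 1 and A = |c|. Against the test functions t_b(x) = (c + x)_b
   the falling factorials have the closed-form pairing
     <m_g, t_b> = const (c)_g (c + g)_b (A + |g| + |b|)_(N - |g|) / (N - |g|)!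
   by the multivariate Vandermonde identity, and the t_b with |b| = n span
   Pi_n^d because sum_i t_(b + e_i) = (A + N + n) t_b on the simplex.
   - For |b| = n - 1 the factor (A + n - 1)_k in the right-hand side cancels;
     expanding (c + g)_b as a Newton series in g, the pairing of the right-hand
     side with t_b becomes a sum of vanishing alternating binomial sums.
   - If f is in V_n, then <m_g, f> / (c)_g is, up to a nonzero factor depending
     only on |g|, a Newton series ft of degree n in g, the same for all |g|.
     It vanishes for |g| < n by orthogonality, so
     ft(alpha) = sum_(|g| = n) m_g(alpha) / g! ft(g): this gives the pairing of
     m_alpha with f from those of the m_g with |g| = n, which are the only ones
     that the right-hand side sees. *)

Set Implicit Arguments.
Unset Strict Implicit.
Unset Printing Implicit Defensive.

Import Order.TTheory GRing.Theory Num.Theory.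
Local Open Scope ring_scope.

(** * One-variable Pochhammer symbols *)

Section PochhammerTheory.
Variable R : realFieldType.
Implicit Types (a b : R) (m n k : nat).

Lemma poch0 a : poch a 0 = 1.
Proof. by rewrite /poch big_ord0. Qed.

Lemma pochSr a n : poch a n.+1 = poch a n * (a + n%:R).
Proof. by rewrite /poch big_ord_recr. Qed.

Lemma pochD a m n : poch a (m + n) = poch a m * poch (a + m%:R) n.
Proof.
elim: n => [|n IHn]; first by rewrite addn0 poch0 mulr1.
by rewrite addnS !pochSr IHn natrD; ring.
Qed.

Lemma pochS a n : poch a n.+1 = a * poch (a + 1) n.
Proof. by rewrite -add1n pochD pochSr poch0 mul1r addr0. Qed.

Lemma poch_gt0 a n : 0 < a -> 0 < poch a n.
Proof. by move=> a_gt0; apply: prodr_gt0 => i _; rewrite ltr_wpDr. Qed.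

Lemma pochN m k : poch (- m%:R : R) k = (-1) ^+ k * (m ^_ k)%:R.
Proof.
elim: k => [|k IHk]; first by rewrite poch0 mulr1.
rewrite pochSr IHk ffactnSr exprS natrM.
have [le_km|lt_mk] := leqP k m; first by rewrite natrB //; ring.
by rewrite ffact_small // !(mulr0, mul0r).
Qed.

Lemma pochN_neq0 m k : (k <= m)%N -> poch (- m%:R : R) k != 0.
Proof.
by move=> le_km; rewrite pochN mulf_neq0 ?signr_eq0 // pnatr_eq0 -lt0n ffact_gt0.
Qed.

Lemma sum_poch_fact a n :
  \sum_(j < n.+1) poch a j / j`!%:R = poch (a + 1) n / n`!%:R.
Proof.
elim: n => [|n IHn]; first by rewrite big_ord_recl big_ord0 addr0 !poch0.
rewrite big_ord_recr /= IHn pochS pochSr factS natrM -natr1.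
have : n`!%:R != 0 :> R by rewrite pnatr_eq0 -lt0n fact_gt0.
have : n%:R + 1 != 0 :> R by rewrite natr1 pnatr_eq0.
by move=> *; field; apply/andP.
Qed.

(** As (-n)_j / j! = (-1)^j binom(n, j), this is the expansion of (1 - 1)^n; the closed form (1 -
    n)_n / n! shows the zero factor. *)
Lemma sum_pochN_fact n : (0 < n)%N ->
  \sum_(j < n.+1) poch (- n%:R : R) j / j`!%:R = 0.
Proof.
case: n => // n _; rewrite sum_poch_fact.
have -> : - n.+1%:R + 1 = - n%:R :> R by rewrite -natr1; ring.
by rewrite pochN ffact_small ?mulr0 ?mul0r.
Qed.

End PochhammerTheory.

(** * Multi-index Pochhammer symbols and falling factorials *)

Section MultiPochhammer.
Variables (R : realFieldType) (D : nat).
Implicit Types (a : 'I_D -> R) (g h x : 'X_{1..D}).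

(** This is m_g(x) = (-1)^|g| (-x)_g, kept in [nat]: it is 0 unless g <= x. *)
Definition mffact x g : nat := (\prod_(i < D) x i ^_ g i)%N.

Lemma pochv0 a : pochv a 0%MM = 1.
Proof. by rewrite /pochv big1 // => i _; rewrite mnm0E poch0. Qed.

Lemma pochvD a g h :
  pochv a (g + h)%MM = pochv a g * pochv (fun i => a i + (g i)%:R) h.
Proof. by rewrite /pochv -big_split; apply: eq_bigr => i _; rewrite mnmDE pochD. Qed.

Lemma pochv_gt0 a g : (forall i, 0 < a i) -> 0 < pochv a g.
Proof. by move=> a_gt0; apply: prodr_gt0 => i _; apply: poch_gt0. Qed.

Lemma pochv1 a i : pochv a U_(i)%MM = a i.
Proof.
rewrite /pochv (bigD1 i) //= mnm1E eqxx pochSr poch0 mul1r addr0 big1 ?mulr1 //.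
by move=> j /negPf ji; rewrite mnm1E eq_sym ji poch0.
Qed.

Lemma pochv_oppv_natpt x g :
  pochv (oppv (natpt R x)) g = (-1) ^+ mdeg g * (mffact x g)%:R.
Proof.
rewrite mdegE -prodrXr natr_prod -big_split.
by apply: eq_bigr => i _; rewrite pochN.
Qed.

Lemma mffact_eq0 x g : ~~ (g <= x)%MM -> mffact x g = 0%N.
Proof.
rewrite -[(g <= x)%MM]/[forall i, (g i <= x i)%N] => /forallPn[i].
by rewrite -ltnNge => lt_xg; rewrite /mffact (bigD1 i) //= ffact_small.
Qed.

Lemma mffact_fact g h : (mffact (g + h) g * mfact h = mfact (g + h))%N.
Proof.
rewrite /mffact /mfact -big_split; apply: eq_bigr => i _ /=.
by rewrite mnmDE -(ffact_fact (leq_addr (h i) (g i))) addKn.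
Qed.

(** Holds even where [x - g] truncates, since both sides are then 0. *)
Lemma mffactD x g h : mffact x (g + h) = (mffact x g * mffact (x - g) h)%N.
Proof.
rewrite /mffact -big_split; apply: eq_bigr => i _ /=.
by rewrite mnmDE mnmBE; elim: (h i) => [|k IHk];
  rewrite ?addn0 ?muln1 // addnS !ffactnSr IHk subnDA mulnA.
Qed.

Lemma mffact1 x i : mffact x U_(i)%MM = x i.
Proof.
rewrite /mffact (bigD1 i) //= mnm1E eqxx ffactn1 big1 ?muln1 // => j.
by rewrite mnm1E eq_sym => /negPf->.
Qed.

Lemma mffact_self x : mffact x x = mfact x.
Proof. by apply: eq_bigr => i _; rewrite ffactnn. Qed.

Lemma mfact_neq0 x : (mfact x)%:R != 0 :> R.
Proof. by rewrite pnatr_eq0 -lt0n prodn_gt0 // => i; apply: fact_gt0. Qed.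

End MultiPochhammer.

(** * Reindexing sums over lattice simplices *)

Section SimplexSums.
Variables (d : nat).
Implicit Types g h : 'X_{1..d.+1}.

Lemma mdeg_simplex N (x : simplex d N) : mdeg x = N.
Proof. by case: x => x /= /eqP. Qed.

Lemma simplexP N h : mdeg h = N -> exists x : simplex d N, h = x.
Proof.
move=> dh; have lt_h : (mdeg h < N.+1)%N by rewrite dh.
have Px : mdeg (BMultinom lt_h) == N by rewrite /= dh.
by exists (Simplex Px).
Qed.

Lemma simplex_inj N (x y : simplex d N) : x = y :> 'X_{1..d.+1} -> x = y.
Proof. by move=> eq_xy; do 2!apply: val_inj. Qed.

Lemma sum_simplex0 (V : nmodType) (G : 'X_{1..d.+1} -> V) :
  \sum_(x : simplex d 0) G x = G 0%MM.
Proof.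
have [z0 Dz0] := simplexP (@mdeg0 d.+1).
rewrite Dz0 (bigD1 z0) //= big1 ?addr0 // => z /eqP[].
apply: simplex_inj; rewrite -Dz0; apply/eqP.
by rewrite -mdeg_eq0 mdeg_simplex.
Qed.

(** Substitute x = g + z: a point x not of this form does not dominate g, so [G] vanishes there. *)
Lemma sum_simplex_shift (V : nmodType) g N (G : 'X_{1..d.+1} -> V) :
    (forall h, ~~ (g <= h)%MM -> G h = 0) ->
  \sum_(x : simplex d (mdeg g + N)) G x = \sum_(z : simplex d N) G (g + z)%MM.
Proof.
move=> G0.
have [f Df] : exists f : simplex d N -> simplex d (mdeg g + N),
    forall z : simplex d N, (g + z)%MM = f z.
  have ex_f (z : simplex d N) : exists x : simplex d (mdeg g + N), (g + z)%MM = x.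
    by apply: simplexP; rewrite mdegD mdeg_simplex.
  by have [f Df] := fin_all_exists ex_f; exists f.
have injf : {in [set: simplex d N] &, injective f}.
  move=> y z _ _ eq_f; apply: simplex_inj.
  by have := Df y; rewrite eq_f -Df => /addmI.
under [RHS]eq_bigr => z _ do rewrite Df.
under [RHS]eq_bigl => z do rewrite -[true](in_setT z).
rewrite -(big_imset (fun x : simplex d (mdeg g + N) => G x) injf) /= [RHS]big_mkcond /=.
apply: eq_bigr => x _; case: ifPn => // fx.
apply: G0; apply: contra fx => le_gx.
have [z Dz] : exists z : simplex d N, (x - g)%MM = z.
  by apply: simplexP; have := mdeg_simplex x; rewrite -{1}(submK le_gx) mdegD; lia.
suff -> : x = f z by apply: imset_f; rewrite inE.
by apply: simplex_inj; rewrite -Df -Dz addmC submK.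
Qed.

End SimplexSums.

(** * The multivariate Vandermonde identity *)

Section Vandermonde.
Variables (R : realFieldType) (d : nat).
Implicit Types (a : 'I_d.+1 -> R) (g h : 'X_{1..d.+1}).

(** With x = g + z, the quotient m_g(x) / x! becomes 1 / z!, and (a)_(g + z) = (a)_g (a + g)_z. *)
Lemma sum_mffact_shift a g N :
  \sum_(x : simplex d (mdeg g + N)) (mffact x g)%:R * (pochv a x / (mfact x)%:R)
  = pochv a g
    * \sum_(z : simplex d N) pochv (fun i => a i + (g i)%:R) z / (mfact z)%:R.
Proof.
rewrite (sum_simplex_shift _ (G := fun h =>
  (mffact h g)%:R * (pochv a h / (mfact h)%:R))) => [|h /mffact_eq0-> //]; last first.
  by rewrite mul0r.
rewrite mulr_sumr; apply: eq_bigr => z _; rewrite pochvD -mffact_fact natrM.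
have := mfact_neq0 R (g + z)%MM; rewrite -mffact_fact natrM mulf_eq0 negb_or.
by case/andP => *; field; apply/andP.
Qed.

(* Multiplying by N + 1 = sum_i x_i and shifting x by e_i reduces degree N + 1
   to degree N with a_i raised by one. *)
Lemma sum_simplex_pochv a N :
  \sum_(x : simplex d N) pochv a x / (mfact x)%:R
  = poch (\sum_i a i) N / N`!%:R.
Proof.
elim: N a => [|N IHN] a.
  rewrite (sum_simplex0 (fun x => pochv a x / (mfact x)%:R)) pochv0 poch0.
  by rewrite /mfact big1 // => i _; rewrite mnm0E.
have nzN : N.+1%:R != 0 :> R by rewrite pnatr_eq0.
apply: (mulfI nzN); transitivity (\sum_i \sum_(x : simplex d N.+1)
    (mffact x U_(i))%:R * (pochv a x / (mfact x)%:R)).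
  rewrite exchange_big mulr_sumr; apply: eq_bigr => x _ /=.
  rewrite -mulr_suml -{1}(mdeg_simplex x) mdegE natr_sum; congr (_ * _).
  by apply: eq_bigr => i _; rewrite mffact1.
rewrite factS natrM invfM mulrCA mulVKf // pochS mulrAC -!mulrA mulr_suml.
apply: eq_bigr => i _; have := sum_mffact_shift a U_(i)%MM N.
rewrite mdeg1 add1n => ->; rewrite pochv1 IHN; congr (_ * _).
rewrite mulrC; congr (_ * poch _ _); rewrite big_split /=; congr (_ + _).
rewrite (bigD1 i) //= mnm1E eqxx big1 ?addr0 // => j.
by rewrite mnm1E eq_sym => /negPf->.
Qed.

Lemma sum_simplex_mffact_pochv a g N : (mdeg g <= N)%N ->
  \sum_(x : simplex d N) (mffact x g)%:R * (pochv a x / (mfact x)%:R)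
  = pochv a g * (poch (\sum_i a i + (mdeg g)%:R) (N - mdeg g)
                  / (N - mdeg g)`!%:R).
Proof.
move=> /subnKC; move: (N - mdeg g)%N => M <-; rewrite sum_mffact_shift sum_simplex_pochv.
by rewrite big_split -natr_sum -mdegE.
Qed.

Lemma sum_simplex_mffact_small a g N : (N < mdeg g)%N ->
  \sum_(x : simplex d N) (mffact x g)%:R * (pochv a x / (mfact x)%:R) = 0.
Proof.
move=> lt_Ng; rewrite big1 // => x _; rewrite mffact_eq0 ?mul0r //.
apply: contraL lt_Ng => /submK def_x.
by rewrite -leqNgt -(mdeg_simplex x) -def_x mdegD leq_addl.
Qed.

End Vandermonde.

(** * Newton series on multi-indices *)

Section Newton.
Variables (R : realFieldType) (d : nat).
Implicit Types (a : 'X_{1..d.+1} -> R) (g h : 'X_{1..d.+1}).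

Definition newton n a g : R :=
  \sum_(k < n.+1) \sum_(h : simplex d k) a h * (mffact g h)%:R.

Lemma sum_simplex_delta n (F : 'X_{1..d.+1} -> R) h : (mdeg h <= n)%N ->
  \sum_(k < n.+1) \sum_(g : simplex d k) (g == h :> 'X_{1..d.+1})%:R * F g = F h.
Proof.
move=> le_hn; rewrite (bigD1 (Ordinal (le_hn : (mdeg h < n.+1)%N))) //=.
have [x Dx] := simplexP (erefl (mdeg h)).
rewrite [X in _ + X]big1 ?addr0 => [|k /eqP neq_k].
  rewrite (bigD1 x) //= -Dx eqxx mul1r big1 ?addr0 // => y /eqP neq_yx.
  case: eqP => [|_]; last by rewrite mul0r.
  by move=> Dy; case: neq_yx; apply: simplex_inj; rewrite Dy.
rewrite big1 // => y _; case: eqP => [Dh|_]; last by rewrite mul0r.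
by case: neq_k; apply: val_inj; rewrite /= -Dh mdeg_simplex.
Qed.

(** Polynomial functions of degree at most n, given by coefficients in the basis m_h, because
    Vandermonde sums are evaluated against the m_h. *)
Definition newton_poly n (f : 'X_{1..d.+1} -> R) := exists a, f =1 newton n a.

Lemma newton_poly_ext n f1 f2 : f1 =1 f2 -> newton_poly n f1 -> newton_poly n f2.
Proof. by move=> eq_f [a Da]; exists a => g; rewrite -eq_f Da. Qed.

Lemma newton_poly_mffact n h : (mdeg h <= n)%N ->
  newton_poly n (fun g => (mffact g h)%:R).
Proof.
move=> le_hn; exists (fun g => (g == h)%:R) => g.
by rewrite /newton (sum_simplex_delta (fun h' => (mffact g h')%:R)).
Qed.

Lemma newton_polyD n f1 f2 : newton_poly n f1 -> newton_poly n f2 ->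
  newton_poly n (fun g => f1 g + f2 g).
Proof.
move=> [a1 D1] [a2 D2]; exists (fun h => a1 h + a2 h) => g.
rewrite D1 D2 -big_split; apply: eq_bigr => k _ /=.
by rewrite -big_split; apply: eq_bigr => h _; rewrite mulrDl.
Qed.

Lemma newton_polyZ n u f : newton_poly n f -> newton_poly n (fun g => u * f g).
Proof.
move=> [a Da]; exists (fun h => u * a h) => g; rewrite Da mulr_sumr.
by apply: eq_bigr => k _; rewrite mulr_sumr; apply: eq_bigr => h _; rewrite mulrA.
Qed.

Lemma newton_poly_sum n (I : Type) (r : seq I) (f : I -> 'X_{1..d.+1} -> R) :
  (forall i, newton_poly n (f i)) -> newton_poly n (fun g => \sum_(i <- r) f i g).
Proof.
move=> nf; elim: r => [|i r IHr].
  exists (fun=> 0) => g; rewrite big_nil /newton.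
  by rewrite big1 // => k _; rewrite big1 // => h _; rewrite mul0r.
by apply: newton_poly_ext (newton_polyD (nf i) IHr) => g; rewrite big_cons.
Qed.

(** From g_i m_h(g) = m_(h + e_i)(g) + h_i m_h(g), multiplication by an affine function of g_i
    raises the degree by at most one. *)
Lemma newton_poly_mulX n f i (c : R) :
  newton_poly n f -> newton_poly n.+1 (fun g => (c + (g i)%:R) * f g).
Proof.
move=> [a Da]; apply: (newton_poly_ext (f1 := fun g => \sum_(k < n.+1)
  \sum_(h : simplex d k) a h * ((mffact g (h + U_(i))%MM)%:R
                                + (c + (h i)%:R) * (mffact g h)%:R))).
  move=> g; rewrite Da mulr_sumr; apply: eq_bigr => k _.
  rewrite mulr_sumr; apply: eq_bigr => h _; rewrite mffactD mffact1 mnmBE.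
  (* The subtraction g_i - h_i is exact when h <= g; otherwise m_h(g) = 0. *)
  have [/mnm_lepP/(_ i) le_hg|/mffact_eq0->] := boolP (h <= g)%MM.
    by rewrite natrM natrB //; ring.
  by rewrite mul0n !(mulr0, addr0).
do 2!apply: newton_poly_sum => ?; apply/newton_polyZ/newton_polyD.
  apply: newton_poly_mffact; rewrite mdegD mdeg1 mdeg_simplex addn1.
  exact: ltn_ord.
apply/newton_polyZ/newton_poly_mffact; rewrite mdeg_simplex.
by rewrite ltnW // ltnS ltnW.
Qed.

Lemma newton_poly_pochv (c : 'I_d.+1 -> R) h :
  newton_poly (mdeg h) (fun g => pochv (fun i => c i + (g i)%:R) h).
Proof.
have [n] := ubnP (mdeg h); elim: n h => // n IHn h.
have [->|nz_h] := eqVneq h 0%MM.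
  move=> _; apply: newton_poly_ext (newton_poly_mffact (leqnn (mdeg 0%MM))).
  by move=> g; rewrite pochv0 /mffact big1 // => i _; rewrite mnm0E.
have /existsP[i hi] : [exists i, h i != 0%N].
  apply: contraNT nz_h => /existsPn h0; apply/eqP/mnmP => i.
  by have := h0 i; rewrite negbK mnm0E => /eqP.
have le_ih : (U_(i) <= h)%MM by rewrite lep1mP.
rewrite -(submK le_ih) mdegD mdeg1 addn1 ltnS => lt_hn.
(* The last factor of (c + g)_h in direction i is c_i + (h_i - 1) + g_i. *)
apply: newton_poly_ext (newton_poly_mulX i (c i + ((h - U_(i))%MM i)%:R) (IHn _ lt_hn)).
by move=> g; rewrite pochvD pochv1 mulrC addrAC.
Qed.

(** Coefficients below size |h| are 0, and for |g| >= |h| the value m_g(h) is nonzero only if g <=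
    h, which forces g = h. *)
Lemma newton_diag n a h : (mdeg h <= n)%N ->
  (forall g, (mdeg g < mdeg h)%N -> a g = 0) -> newton n a h = a h * (mfact h)%:R.
Proof.
move=> le_hn a0; rewrite -mffact_self.
rewrite -(sum_simplex_delta (fun g => a g * (mffact h g)%:R) le_hn).
apply: eq_bigr => k _; apply: eq_bigr => g _.
case: eqP => [_|neq_gh]; first by rewrite mul1r.
rewrite mul0r; have [/a0->|le_hg] := ltnP (mdeg g) (mdeg h); first by rewrite mul0r.
rewrite mffact_eq0 ?mulr0 //; apply/negP => le_gh; case: neq_gh.
have := submK le_gh => Dh; move: (congr1 mdeg Dh); rewrite mdegD => dh.
have /eqP : mdeg (h - g) = 0%N by lia.
by rewrite mdeg_eq0 => /eqP h_g0; rewrite -Dh h_g0 add0m.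
Qed.

(* A Newton series of degree n vanishing on all points of size < n is
   homogeneous, hence determined by its values on the points of size n. *)
Lemma newton_interpolation n f : newton_poly n f ->
    (forall g, (mdeg g < n)%N -> f g = 0) ->
  forall g, f g = \sum_(h : simplex d n) (mffact g h)%:R / (mfact h)%:R * f h.
Proof.
case=> a Da f0.
have a0 g : (mdeg g < n)%N -> a g = 0.
  have [k] := ubnP (mdeg g); elim: k g => // k IHk g lt_gk lt_gn.
  have := newton_diag (ltnW lt_gn) (fun h lt_hg =>
    IHk h (leq_trans lt_hg lt_gk) (ltn_trans lt_hg lt_gn)).
  by rewrite -Da f0 // => /esym/eqP; rewrite mulf_eq0 (negPf (mfact_neq0 R g)) orbF => /eqP.
move=> g; rewrite Da /newton big_ord_recr /= big1 ?add0r => [|k _].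
  apply: eq_bigr => h _; rewrite Da newton_diag ?mdeg_simplex //.
  by have := mfact_neq0 R h => nz; field.
by rewrite big1 // => h _; rewrite a0 ?mul0r // mdeg_simplex.
Qed.

End Newton.

(** Expand f in the m_h. For each h, Vandermonde with parameters -alpha sums over g, and what is
    left is an alternating binomial sum of order n - |h| > 0. *)
Lemma sum_pochN_newton_poly (R : realFieldType) (d n m b : nat)
    (alpha : 'X_{1..d.+1}) (f : 'X_{1..d.+1} -> R) :
    mdeg alpha = m -> (b < n)%N -> (n <= m)%N -> newton_poly b f ->
  \sum_(k < n.+1) poch (- n%:R) k / poch (- m%:R) k *
    \sum_(g : simplex d k)
      pochv (oppv (natpt R alpha)) g / (mfact g)%:R * f g = 0.
Proof.
move=> dalpha lt_bn le_nm [a Da]; set u := oppv _.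
transitivity (\sum_(j < b.+1) \sum_(h : simplex d j) a h *
  \sum_(k < n.+1) poch (- n%:R) k / poch (- m%:R) k *
    \sum_(g : simplex d k) (mffact g h)%:R * (pochv u g / (mfact g)%:R)).
  under [RHS]eq_bigr => j _ do under eq_bigr => h _ do rewrite mulr_sumr.
  under [RHS]eq_bigr => j _ do rewrite exchange_big /=.
  rewrite [RHS]exchange_big /=; apply: eq_bigr => k _.
  under eq_bigr => g _ do rewrite Da /newton mulr_sumr.
  rewrite exchange_big mulr_sumr; apply: eq_bigr => j _ /=.
  under eq_bigr => g _ do rewrite mulr_sumr.
  rewrite exchange_big mulr_sumr; apply: eq_bigr => h _ /=.
  by rewrite !mulr_sumr; apply: eq_bigr => g _; ring.
apply: big1 => j _; apply: big1 => h _; set e := mdeg h.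
suff -> : \sum_(k < n.+1) poch (- n%:R) k / poch (- m%:R) k *
    (\sum_(g : simplex d k) (mffact g h)%:R * (pochv u g / (mfact g)%:R)) = 0.
  by rewrite mulr0.
have lt_en : (e < n)%N by rewrite /e mdeg_simplex; have := ltn_ord j; lia.
rewrite -(big_mkord xpredT (fun k => poch (- n%:R) k / poch (- m%:R) k *
  \sum_(g : simplex d k) (mffact g h)%:R * (pochv u g / (mfact g)%:R))).
(* Terms with k < e vanish, as no g of size k dominates h; the others are reindexed by k = i + e. *)
rewrite (big_cat_nat (n := e)) //=; last by lia.
rewrite big_nat big1 ?add0r => [|k lt_ke]; last by rewrite sum_simplex_mffact_small ?mulr0.
rewrite -{1}[e]add0n big_addn subSn ?(ltnW lt_en) // big_mkord.
have sum_u : \sum_i u i = - m%:R.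
  by rewrite -dalpha mdegE natr_sum -sumrN.
(* Vandermonde yields (e - m)_i / i!, and (-m)_(e + i) = (-m)_e (e - m)_i cancels its numerator. *)
transitivity (\sum_(i < (n - e).+1) (poch (- n%:R) e / poch (- m%:R) e * pochv u h)
   * (poch (- (n - e)%:R : R) i / i`!%:R)).
  apply: eq_bigr => i _; rewrite sum_simplex_mffact_pochv ?leq_addl // addnK sum_u.
  rewrite addnC !pochD -/e.
  have -> : - n%:R + e%:R = - (n - e)%:R :> R by rewrite natrB 1?ltnW //; ring.
  have -> : - m%:R + e%:R = - (m - e)%:R :> R.
    by rewrite natrB; [ring | lia].
  have nz1 : poch (- m%:R) e != 0 :> R by apply: pochN_neq0; lia.
  have nz2 : poch (- (m - e)%:R) i != 0 :> R.
    by apply: pochN_neq0; have := ltn_ord i; lia.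
  have nz3 : i`!%:R != 0 :> R by rewrite pnatr_eq0 -lt0n fact_gt0.
  by field; rewrite nz1 nz2 nz3.
by rewrite -mulr_sumr sum_pochN_fact ?mulr0 // subn_gt0.
Qed.

(** * Pairings for the Hahn inner product *)

Section HahnTheory.
Variables (R : realFieldType) (d N : nat) (kappa : 'I_d.+1 -> R).
Hypothesis kappa_gt : forall i, -1 < kappa i.
Implicit Types (g h b alpha : 'X_{1..d.+1}) (f : {ffun simplex d N -> R^o}).

Local Notation c := (shift1 kappa).
Local Notation A := (ksum kappa + d.+1%:R).
Local Notation fsp := {ffun simplex d N -> R^o}.

Definition mffun g : fsp := [ffun x : simplex d N => (mffact x g)%:R].
(** The test function t_b: multiplied by the weight factor (c)_x it gives (c)_(x + b), again a
    Pochhammer symbol. *)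
Definition pochfun b : fsp := [ffun x : simplex d N => pochv (fun i => c i + (x i)%:R) b].
Definition mulX i f : fsp := [ffun x : simplex d N => (x i)%:R * f x].
Definition pochsp n : {vspace fsp} := (\sum_(b : simplex d n) <[pochfun b]>)%VS.

Lemma shift1_gt0 i : 0 < c i.
Proof. by rewrite /shift1 -ltrBlDr sub0r. Qed.

Lemma sum_shift1 : \sum_i c i = A.
Proof. by rewrite big_split /= sumr_const card_ord. Qed.

Lemma ksum_gt0 : 0 < A.
Proof.
rewrite -sum_shift1 (bigD1 ord0) //= ltr_pwDl ?shift1_gt0 //.
by apply: sumr_ge0 => i _; apply/ltW/shift1_gt0.
Qed.

Lemma monoE alpha : mono R N alpha = mffun alpha.
Proof.
by apply/ffunP=> x; rewrite !ffunE pochv_oppv_natpt mulrA -exprMn mulrNN mulr1 expr1n mul1r.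
Qed.

(** Since (c)_x (c + x)_b = (c)_b (c + b)_x, the sum is a Vandermonde sum with parameters c + b;
    then (c)_b (c + b)_g = (c)_g (c + g)_b. *)
Lemma hahn_dot_mffun_pochfun g b : (mdeg g <= N)%N ->
  hahn_dot kappa (mffun g) (pochfun b) =
    N`!%:R / poch A N * pochv c g * pochv (fun i => c i + (g i)%:R) b
    * (poch (A + (mdeg g + mdeg b)%:R) (N - mdeg g) / (N - mdeg g)`!%:R).
Proof.
move=> le_gN; rewrite /hahn_dot -!mulrA; congr (_ * (_ * _)).
transitivity (pochv c b * \sum_(x : simplex d N) (mffact x g)%:R
    * (pochv (fun i => c i + (b i)%:R) x / (mfact x)%:R)).
  rewrite mulr_sumr; apply: eq_bigr => x _; rewrite !ffunE.
  have := congr1 (pochv c) (addmC x b); rewrite !pochvD => Exb.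
  transitivity ((mffact x g)%:R * (pochv c x * pochv (fun i => c i + (x i)%:R) b)
    / (mfact x)%:R); first by ring.
  by rewrite Exb; ring.
rewrite sum_simplex_mffact_pochv // [in RHS]mulrA -pochvD addmC pochvD -mulrA.
congr (_ * (_ * (poch _ _ / _))).
by rewrite big_split -natr_sum -mdegE sum_shift1 /= natrD; ring.
Qed.

(** All weights are positive because every c_i is, so each square in the sum must vanish. *)
Lemma hahn_dot_definite f : hahn_dot kappa f f = 0 -> f = 0.
Proof.
move=> /eqP; rewrite mulf_eq0 mulf_eq0 invr_eq0 pnatr_eq0 -leqn0 leqNgt fact_gt0 /=.
rewrite (gt_eqF (poch_gt0 _ ksum_gt0)) /= psumr_eq0 => [/allP f0|x _]; last first.
  rewrite mulr_ge0 ?(sqr_ge0 (f x : R)) // divr_ge0 ?ler0n //.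
  by apply/ltW/pochv_gt0/shift1_gt0.
apply/ffunP => x; rewrite ffunE; have := f0 x; rewrite mem_index_enum => /(_ isT).
rewrite /= mulf_eq0 (gt_eqF (divr_gt0 _ _)) ?orbF ?mulf_eq0 ?orbb => [/eqP //||].
  exact/pochv_gt0/shift1_gt0.
by rewrite lt_neqAle ler0n eq_sym mfact_neq0.
Qed.

(** * Polynomial spaces and the span of the test functions *)

Lemma coord_poly (i : 'I_d.+1) : exists2 q : {mpoly R[d]}, (msize q <= 2)%N &
  forall x : simplex d N, (poly_fun N q) x = (x i)%:R.
Proof.
case: (unliftP ord_max i) => [j|] ->.
  exists 'X_j => [|x]; first by rewrite msizeX mdeg1.
  rewrite ffunE mevalXU; congr (_%:R); congr (fun_of_multinom x _).
  by apply: val_inj; rewrite /= /bump leqNgt ltn_ord.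
(* The last coordinate is N minus the sum of the others; [msize] is the degree plus one. *)
exists (N%:R%:MP - \sum_(j < d) 'X_j) => [|x].
  apply: leq_trans (msizeD_le _ _) _; rewrite geq_max msizeN.
  rewrite msizeC; apply/andP; split; first by case: (_ == 0).
  elim/big_ind: _ => [|p q lep leq|j _]; first by rewrite msize0.
    by apply: leq_trans (msizeD_le _ _) _; rewrite geq_max lep.
  by rewrite msizeX mdeg1.
rewrite ffunE mevalB mevalC [X in _ - X]raddf_sum /= -{1}(mdeg_simplex x) mdegE big_ord_recr /=.
rewrite natrD natr_sum; under [X in _ - X]eq_bigr => j _ do rewrite mevalXU.
by rewrite addrC addKr.
Qed.

Lemma mulX_polysp k i f : f \in polysp R d N k -> mulX i f \in polysp R d N k.+1.
Proof.
case/polyspP=> p le_pk ->; have [q le_q2 Dq] := coord_poly i.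
apply/polyspP; exists (q * p).
  have [->|nzq] := eqVneq q 0; first by rewrite mul0r msize0.
  have [->|nzp] := eqVneq p 0; first by rewrite mulr0 msize0.
  by rewrite msizeM // -subn1 leq_subLR; apply: leq_add le_q2 le_pk.
by apply/ffunP => x; rewrite !ffunE mevalM -Dq ffunE.
Qed.

Lemma polyspS j k : (j <= k)%N -> (polysp R d N j <= polysp R d N k)%VS.
Proof.
move=> le_jk; apply/subvP => f /polyspP[p le_pj ->].
by apply/polyspP; exists p => //; apply: leq_trans le_pj le_jk.
Qed.

Lemma mdeg_ind (P : 'X_{1..d.+1} -> Prop) :
  P 0%MM -> (forall i g, P g -> P (g + U_(i))%MM) -> forall g, P g.
Proof.
move=> P0 PS g; rewrite [g]multinomUE_id.
elim/big_rec: _ => // i h _ Ph; elim: (g i) => [|k IHk]; first by rewrite add0m.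
by rewrite mulmS -addmA addmC; apply: PS.
Qed.

(** Induction on g through m_(g + e_i) = (x_i - g_i) m_g. *)
Lemma mffun_polysp g : mffun g \in polysp R d N (mdeg g).+1.
Proof.
elim/mdeg_ind: g => [|i g IHg].
  apply/polyspP; exists 1; first by rewrite mdeg0 msize1.
  apply/ffunP => x; rewrite !ffunE meval1 /mffact big1 // => i _.
  by rewrite mnm0E.
have -> : mffun (g + U_(i)) = mulX i (mffun g) - (g i)%:R *: mffun g.
  apply/ffunP => x; rewrite !ffunE mffactD mffact1 mnmBE.
  rewrite [_ *: _](_ : _ = (g i)%:R * (mffact x g)%:R :> R) //.
  have [/mnm_lepP/(_ i) le_gx|/mffact_eq0->] := boolP (g <= x)%MM.
    by rewrite natrM natrB //; ring.
  by rewrite mul0n !mulr0 subr0.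
rewrite mdegD mdeg1 addn1 memvB ?mulX_polysp // memvZ //.
exact: (subvP (polyspS (leqnSn _))).
Qed.

Lemma mem_pochsp b n : mdeg b = n -> pochfun b \in pochsp n.
Proof.
by move=> /simplexP[x ->]; apply/(sumv_sup x isT)/memv_line.
Qed.

Lemma pochspP n f : reflect
  (exists a : simplex d n -> R, f = \sum_(b : simplex d n) a b *: pochfun b)
  (f \in pochsp n).
Proof.
apply: (iffP memv_sumP) => [[v /= vP ->]|[a ->]]; last first.
  by exists (fun b : simplex d n => a b *: pochfun b) => // b _; apply/memvZ/memv_line.
have ex_a (b : simplex d n) : exists u, v b = u *: pochfun b.
  by have /vlineP[u] := vP b isT; exists u.
by have [a Da] := fin_all_exists ex_a; exists a; apply: eq_bigr => b _.
Qed.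

Lemma pochfunD1 b i :
  pochfun (b + U_(i)) = mulX i (pochfun b) + (c i + (b i)%:R) *: pochfun b.
Proof.
apply/ffunP => x; rewrite !ffunE pochvD pochv1.
by rewrite [_ *: _](_ : _ = (c i + (b i)%:R) * pochv (fun i => c i + (x i)%:R) b :> R) //; ring.
Qed.

(** On the simplex the factors c_i + b_i + x_i add up to the constant A + n + N > 0, so t_b is a
    multiple of the sum of the t_(b + e_i). *)
Lemma pochspS n : (pochsp n <= pochsp n.+1)%VS.
Proof.
apply/subvP => f /pochspP[a ->]; apply: memv_suml => b _; apply: memvZ.
have nzA : A + N%:R + n%:R != 0.
  by rewrite gt_eqF // -addrA ltr_pwDl ?ksum_gt0 // addr_ge0.
have -> : pochfun b = (A + N%:R + n%:R)^-1 *: \sum_i pochfun (b + U_(i)).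
  apply: (canRL (scalerK nzA)); apply/ffunP => x; rewrite sum_ffunE !ffunE.
  rewrite [LHS](_ : _ = (A + N%:R + n%:R) * pochv (fun i => c i + (x i)%:R) b :> R) //.
  under eq_bigr => i _ do rewrite ffunE pochvD pochv1 mulrC.
  rewrite -mulr_suml !big_split /= -(big_split _ _ _ (fun i => kappa i) (fun=> 1)) /=.
  by rewrite sum_shift1 -!natr_sum -!mdegE !mdeg_simplex.
by apply/memvZ/memv_suml => i _; apply: mem_pochsp; rewrite mdegD mdeg1 mdeg_simplex addn1.
Qed.

(** Here x_i t_b = t_(b + e_i) - (c_i + b_i) t_b, and [pochspS] lifts the second term. *)
Lemma mulX_pochsp n i f : f \in pochsp n -> mulX i f \in pochsp n.+1.
Proof.
case/pochspP=> a ->; have -> : mulX i (\sum_(b : simplex d n) a b *: pochfun b)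
    = \sum_(b : simplex d n) a b *: mulX i (pochfun b).
  apply/ffunP => x; rewrite ffunE !sum_ffunE mulr_sumr; apply: eq_bigr => b _.
  by rewrite !ffunE [LHS]mulrCA.
apply: memv_suml => b _; apply: memvZ.
rewrite -[mulX _ _](addrK ((c i + (b i)%:R) *: pochfun b)) -pochfunD1 memvB //.
  by apply: mem_pochsp; rewrite mdegD mdeg1 mdeg_simplex addn1.
by apply/memvZ/(subvP (pochspS n))/mem_pochsp; rewrite mdeg_simplex.
Qed.

Lemma monomial_pochsp n (b : 'X_{1..d}) :
  (mdeg b <= n)%N -> poly_fun N 'X_[b] \in pochsp n.
Proof.
elim: n b => [|n IHn] b.
  rewrite leqn0 mdeg_eq0 => /eqP->.
  have -> : poly_fun N 'X_[0] = pochfun 0.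
    by apply/ffunP => x; rewrite !ffunE pochv0 mpolyX0 meval1.
  by apply: mem_pochsp; rewrite mdeg0.
have [->|nz_b] := eqVneq b 0%MM.
  by move=> _; apply/(subvP (pochspS n))/IHn; rewrite mdeg0.
have /existsP[i bi] : [exists i, b i != 0%N].
  apply: contraNT nz_b => /existsPn b0; apply/eqP/mnmP => i.
  by have := b0 i; rewrite negbK mnm0E => /eqP.
have le_ib : (U_(i) <= b)%MM by rewrite lep1mP.
rewrite -(submK le_ib) mdegD mdeg1 addn1 ltnS => le_bn.
have -> : poly_fun N 'X_[(b - U_(i)) + U_(i)]
    = mulX (widen_ord (leqnSn d) i) (poly_fun N ('X_[R, b - U_(i)])).
  by apply/ffunP => x; rewrite !ffunE mpolyXD mevalM mevalXU mulrC.
exact/mulX_pochsp/IHn.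
Qed.

(** Reduces orthogonality to polynomials of degree at most n to the t_b with |b| = n, and lets
    elements of V_n be expanded in them. *)
Lemma polysp_pochsp n : (polysp R d N n.+1 <= pochsp n)%VS.
Proof.
apply/subvP => f /polyspP[p le_pn ->].
rewrite [p](mpolywE le_pn) raddf_sum /= memv_suml // => b _.
by rewrite linearZ memvZ //; apply: monomial_pochsp; rewrite -ltnS bmdeg.
Qed.


(** * The functions E_k(alpha, .) and their pairings *)

Definition kernfun alpha k : fsp := \sum_(g : simplex d k)
  ((mffact alpha g)%:R / ((mfact g)%:R * pochv c g)) *: mffun g.

Lemma kernfunE alpha (x : simplex d N) k :
  kernfun alpha k x = E_ k (natpt R alpha) (natpt R x) kappa.
Proof.
rewrite /E_; case: eqP => [->|_]; rewrite /kernfun sum_ffunE.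
  rewrite (sum_simplex0 (fun g =>
    (((mffact alpha g)%:R / ((mfact g)%:R * pochv c g)) *: mffun g) x)).
  have mffact0 h : mffact h 0 = 1%N by rewrite /mffact big1 // => i _; rewrite mnm0E.
  rewrite !ffunE pochv0 -mffact_self !mffact0.
  by rewrite [LHS](_ : _ = 1 / (1 * 1) * 1 :> R) // !mulr1 divr1.
apply: eq_bigr => g _; rewrite !ffunE !pochv_oppv_natpt mulrACA -exprMn mulrNN.
by rewrite mulr1 expr1n mul1r [LHS]mulrAC.
Qed.

Lemma kernfun_polysp alpha k n : (k <= n)%N -> kernfun alpha k \in polysp R d N n.+1.
Proof.
move=> le_kn; apply: memv_suml => g _; apply: memvZ.
apply: (subvP (polyspS (le_kn : (k.+1 <= n.+1)%N))).
by have := mffun_polysp g; rewrite mdeg_simplex.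
Qed.

Lemma hahn_dot_kernfun alpha k f :
  hahn_dot kappa (kernfun alpha k) f = \sum_(g : simplex d k)
    (mffact alpha g)%:R / ((mfact g)%:R * pochv c g) * hahn_dot kappa (mffun g) f.
Proof.
by rewrite linear_sumlz; apply: eq_bigr => g _; rewrite linearZl_LR.
Qed.

(** All t_b with |b| = n share the same tail factor, so linearity only combines the Newton series (c
    + g)_b. *)
Lemma hahn_dot_mffun_pochsp n f : f \in pochsp n ->
  exists2 t : 'X_{1..d.+1} -> R, newton_poly n t &
  forall g, (mdeg g <= N)%N -> hahn_dot kappa (mffun g) f =
    N`!%:R / poch A N * pochv c g * t g
    * (poch (A + (mdeg g + n)%:R) (N - mdeg g) / (N - mdeg g)`!%:R).
Proof.
case/pochspP=> a ->.
exists (fun g => \sum_(b : simplex d n) a b * pochv (fun i => c i + (g i)%:R) b).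
  apply: newton_poly_sum => b; apply: newton_polyZ.
  by have := newton_poly_pochv c b; rewrite mdeg_simplex.
move=> g le_gN; rewrite linear_sumr [in RHS]mulr_sumr [in RHS]mulr_suml.
apply: eq_bigr => b _ /=.
by rewrite linearZr_LR /= hahn_dot_mffun_pochfun // mdeg_simplex; ring.
Qed.

Lemma hahn_dot_Vsp n f g : f \in Vsp N kappa n -> (mdeg g < n)%N ->
  hahn_dot kappa (mffun g) f = 0.
Proof.
rewrite memv_cap => /andP[_ /mem_orthovP f_orth] lt_gn.
rewrite hahn_dotC f_orth //; apply: (subvP (polyspS lt_gn)).
exact: mffun_polysp.
Qed.

(** The Newton series [t] of f vanishes below size n, so t(alpha) is interpolated from the t(g) with
    |g| = n, which are what E_n(alpha, .) pairs with. The tail factors account for the two sizes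
    |alpha| and n. *)
Lemma hahn_dot_kernfun_Vsp n alpha f :
    (n <= mdeg alpha <= N)%N -> f \in Vsp N kappa n ->
  hahn_dot kappa (kernfun alpha n) f
    * (poch (A + (mdeg alpha + n)%:R) (N - mdeg alpha) / (N - mdeg alpha)`!%:R)
  = hahn_dot kappa (mffun alpha) f / pochv c alpha
    * (poch (A + (n + n)%:R) (N - n) / (N - n)`!%:R).
Proof.
case/andP=> le_na le_aN Vf.
have f_poch : f \in pochsp n.
  by apply: (subvP (polysp_pochsp n)); move: Vf; rewrite memv_cap => /andP[].
have [t nt Dt] := hahn_dot_mffun_pochsp f_poch.
have nz_poch r s : poch (A + r%:R) s != 0.
  by rewrite gt_eqF // poch_gt0 // ltr_wpDr // ksum_gt0.
have nzA s : poch A s != 0 by have := nz_poch 0%N s; rewrite addr0.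
have nz_c g : pochv c g != 0 by rewrite gt_eqF // pochv_gt0 // => i; apply: shift1_gt0.
have nz_fact s : s`!%:R != 0 :> R by rewrite pnatr_eq0 -lt0n fact_gt0.
(* All other factors of the closed form are nonzero, so the vanishing of the pairing passes to
   [t]. *)
have t0 g : (mdeg g < n)%N -> t g = 0.
  move=> lt_gn; have := hahn_dot_Vsp Vf lt_gn; rewrite Dt; last by lia.
  by move/eqP; rewrite !mulf_eq0 !invr_eq0 !(negPf (nz_poch _ _)) (negPf (nzA _))
    (negPf (nz_c _)) !(negPf (nz_fact _)) /= orbF => /eqP.
rewrite hahn_dot_kernfun Dt // (newton_interpolation nt t0 alpha).
transitivity ((N`!%:R / poch A N * (poch (A + (n + n)%:R) (N - n) / (N - n)`!%:R)
    * (poch (A + (mdeg alpha + n)%:R) (N - mdeg alpha) / (N - mdeg alpha)`!%:R))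
  * \sum_(g : simplex d n) (mffact alpha g)%:R / (mfact g)%:R * t g).
  rewrite [in RHS]mulr_sumr mulr_suml; apply: eq_bigr => g _.
  rewrite Dt mdeg_simplex; last exact: leq_trans le_aN.
  have := nz_c g; have := mfact_neq0 R g => nz1 nz2.
  by field; rewrite nz1 nz2 !nz_fact nzA.
by field; rewrite nz_c !nz_fact nzA.
Qed.

(** The right-hand side of the formula without its prefactor. *)
Definition hahn_kernel alpha n : fsp := \sum_(k < n.+1)
  ((poch (- n%:R) k * poch (ksum kappa + d%:R + n%:R) k)
     / (poch (- (mdeg alpha)%:R) k * poch (- N%:R) k)) *: kernfun alpha k.

Lemma hahn_dot_kernel_pochfun alpha n b :
    (n <= mdeg alpha <= N)%N -> mdeg b = n.-1 -> (0 < n)%N ->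
  hahn_dot kappa (hahn_kernel alpha n) (pochfun b) = 0.
Proof.
case/andP=> le_na le_aN db n_gt0.
have DA : ksum kappa + d%:R + n%:R = A + (n.-1)%:R.
  by rewrite -{1}(prednK n_gt0) -!natr1; ring.
have nzAn k : poch (A + n.-1%:R) k != 0.
  by rewrite gt_eqF // poch_gt0 // ltr_wpDr // ksum_gt0.
have nz_c g : pochv c g != 0 by rewrite gt_eqF // pochv_gt0 // => i; apply: shift1_gt0.
have nz_fact s : s`!%:R != 0 :> R by rewrite pnatr_eq0 -lt0n fact_gt0.
rewrite linear_sumlz /=.
(* The product (A + n - 1)_k (A + n - 1 + k)_(N - k) = (A + n - 1)_N is free of k. Also N! / (N -
   k)! cancels (-N)_k up to the sign (-1)^k, which turns m_g(alpha) into (-alpha)_g. *)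
transitivity (1 / poch A N * poch (A + n.-1%:R) N * \sum_(k < n.+1)
    poch (- n%:R) k / poch (- (mdeg alpha)%:R) k * \sum_(g : simplex d k)
    pochv (oppv (natpt R alpha)) g / (mfact g)%:R * pochv (fun i => c i + (g i)%:R) b).
  rewrite mulr_sumr; apply: eq_bigr => k _; rewrite linearZl_LR /= hahn_dot_kernfun.
  have le_kn : (k <= n)%N by rewrite -ltnS ltn_ord.
  have le_kN : (k <= N)%N by lia.
  rewrite !mulr_sumr; apply: eq_bigr => g _.
  rewrite hahn_dot_mffun_pochfun mdeg_simplex // pochv_oppv_natpt mdeg_simplex DA db.
  have := pochD (A + n.-1%:R) k (N - k); rewrite subnKC // => ->.
  have -> : A + n.-1%:R + k%:R = A + (k + n.-1)%:R by rewrite natrD; ring.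
  have := pochN_neq0 R le_kN; rewrite pochN => nz1.
  have := pochN_neq0 R (leq_trans le_kn le_na) => nz2.
  have := ffact_fact le_kN => /(congr1 (fun s : nat => s%:R : R)); rewrite natrM => <-.
  have := nz_c g; have := mfact_neq0 R g; have := nzAn k => nz3 nz4 nz5.
  have nz6 : poch A N != 0 by rewrite gt_eqF // poch_gt0 // ksum_gt0.
  move: nz1; rewrite mulf_eq0 signr_eq0 /= => nz1.
  rewrite [(poch _ _ * (_ * _))^-1]invfM [(_ ^+ k * _)^-1]invfM invr_sign.
  by field; rewrite nz1 nz2 nz4 nz5 nz6 nz_fact.
rewrite (@sum_pochN_newton_poly _ _ _ (mdeg alpha) (mdeg b) alpha
  (fun g => pochv (fun i => c i + (g i)%:R) b)) ?mulr0 //.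
  by rewrite db prednK.
exact: newton_poly_pochv.
Qed.

Lemma hahn_kernel_Vsp alpha n :
  (n <= mdeg alpha <= N)%N -> hahn_kernel alpha n \in Vsp N kappa n.
Proof.
move=> le_n; rewrite memv_cap; apply/andP; split.
  apply: memv_suml => k _; apply/memvZ/kernfun_polysp.
  by rewrite -ltnS ltn_ord.
apply/mem_orthovP => f; case: n le_n => [|n] le_n.
  (* For n = 0 the space of lower degree is zero. *)
  case/polyspP => p; rewrite leqn0 msize_poly_eq0 => /eqP-> ->.
  by rewrite !linear0.
move=> /(subvP (polysp_pochsp n)) /pochspP[a ->]; rewrite linear_sumr big1 // => b _.
by rewrite linearZr_LR /= hahn_dot_kernel_pochfun ?mulr0 // mdeg_simplex.
Qed.

(** Only k = n survives, as f is orthogonal to every m_g with |g| < n. *)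
Lemma hahn_dot_kernel_Vsp alpha n f : f \in Vsp N kappa n ->
  hahn_dot kappa (hahn_kernel alpha n) f =
    (poch (- n%:R) n * poch (ksum kappa + d%:R + n%:R) n)
     / (poch (- (mdeg alpha)%:R) n * poch (- N%:R) n)
    * hahn_dot kappa (kernfun alpha n) f.
Proof.
move=> Vf; rewrite linear_sumlz big_ord_recr /= linearZl_LR big1 ?add0r // => k _.
rewrite linearZl_LR /= hahn_dot_kernfun big1 ?mulr0 // => g _.
by rewrite (hahn_dot_Vsp Vf) ?mulr0 // mdeg_simplex.
Qed.

(** Definiteness makes V_n meet its complement trivially, and v - u lies in that complement, so its
    V_n-component is 0. *)
Lemma projV_eq n u v : u \in Vsp N kappa n -> v \in polysp R d N N.+1 ->
    {in Vsp N kappa n, forall f, hahn_dot kappa (v - u) f = 0} -> (n <= N)%N ->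
  projV N kappa n v = u.
Proof.
move=> Vu Pv orth_vu le_nN; rewrite /projV; set V := Vsp _ _ _; set W := (_ :&: _)%VS.
have VW0 : (V :&: W = 0)%VS.
  apply/eqP; rewrite -subv0; apply/subvP => f; rewrite memv_cap [f \in W]memv_cap memv0.
  case/and3P=> Vf _ /mem_orthovP /(_ f Vf) f0; apply/eqP.
  exact: hahn_dot_definite.
have Wvu : v - u \in W.
  rewrite memv_cap memvB //=; first by apply/mem_orthovP.
  by apply: (subvP (polyspS (le_nN : (n.+1 <= N.+1)%N))); move: Vu; rewrite memv_cap => /andP[].
have vu0 : daddv_pi V W (v - u) = 0.
  have : v - u \in (V + W)%VS by apply: (subvP (addvSr _ _)).
  move/(daddv_pi_add VW0); rewrite (@daddv_pi_id _ _ W) // 1?capvC //.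
  by rewrite -[RHS]add0r => /addIr.
by rewrite -[v](subrK u) linearD /= vu0 add0r daddv_pi_id.
Qed.

End HahnTheory.

(** * The normalising constant and the final comparison *)

(** The left side is the prefactor times the coefficient of E_n; here B stands for |kappa| + d. *)
Lemma hahn_constant (R : realFieldType) (A B : R) (n m N : nat) :
    A = B + 1 -> 0 < A -> (n <= m <= N)%N ->
  ((-1) ^+ m * poch (- N%:R) m * poch (- m%:R) n * poch A n)
      / (n`!%:R * poch A (m + n))
    * (if n == 0%N then 1 else (B + (2 * n)%:R) / (B + n%:R))
    * (poch (- n%:R) n * poch (B + n%:R) n / (poch (- m%:R) n * poch (- N%:R) n))
  = poch A (n + n) * (N - n)`!%:R / (poch A (m + n) * (N - m)`!%:R).
Proof.
move=> DA A_gt0 /andP[le_nm le_mN]; have le_nN := leq_trans le_nm le_mN.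
have nzA s : poch A s != 0 by rewrite gt_eqF // poch_gt0.
have nz_fact s : s`!%:R != 0 :> R by rewrite pnatr_eq0 -lt0n fact_gt0.
have nz_m := pochN_neq0 R le_nm; have nz_N := pochN_neq0 R le_nN.
(* For n > 0 the ratio replaces the first factor of (B + n)_n by B + 2n, which gives (A + n)_n. For
   n = 0 both symbols are 1, whereas B itself may be 0. *)
have ratioE : (if n == 0%N then 1 else (B + (2 * n)%:R) / (B + n%:R))
    * (poch (- n%:R) n * poch (B + n%:R) n / (poch (- m%:R) n * poch (- N%:R) n))
  = poch (- n%:R) n * poch (A + n%:R) n / (poch (- m%:R) n * poch (- N%:R) n).
  case: n le_nm le_nN nz_m nz_N => [|n] _ _ nz_m nz_N; first by rewrite /= mul1r !poch0.
  have nzB : B + n.+1%:R != 0 by rewrite gt_eqF // -natr1 addrCA -DA ltr_wpDl.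
  rewrite [poch (B + _) _]pochS [poch (A + _) _]pochSr.
  have -> : A + n.+1%:R = B + n.+1%:R + 1 by rewrite DA; ring.
  have -> : B + n.+1%:R + 1 + n%:R = B + (2 * n.+1)%:R by rewrite natrM -natr1; ring.
  by move: nzB; set u := B + _ => nzB /=; field; rewrite nzB nz_m nz_N.
rewrite -[LHS]mulrA ratioE (pochD A n n).
have fact_split k : (k <= N)%N -> N`!%:R = (N ^_ k)%:R * (N - k)`!%:R :> R.
  by move=> le_kN; rewrite -natrM ffact_fact.
have DNm : (N ^_ m)%:R = N`!%:R / (N - m)`!%:R :> R by rewrite (fact_split m) // mulfK.
have DNn : (N ^_ n)%:R = N`!%:R / (N - n)`!%:R :> R by rewrite (fact_split n) // mulfK.
have -> : (-1) ^+ m * poch (- N%:R) m = (N ^_ m)%:R :> R.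
  by rewrite pochN mulrA -exprMn mulrNN mulr1 expr1n mul1r.
rewrite (pochN _ N n) (pochN _ n) ffactnn DNm DNn.
by field; rewrite nzA nz_m !nz_fact signr_eq0.
Qed.

Theorem proposition3p11 (R : realFieldType) (d n m N : nat)
    (kappa : 'I_d.+1 -> R) (alpha : simplex d m) (x : simplex d N)
    (hd : (1 <= d)%N) (hnm : (n <= m)%N) (hmN : (m <= N)%N)
    (hkappa : forall i, -1 < kappa i) :
  Q_ N kappa alpha n x =
    ((-1) ^+ m * poch (- N%:R) m * poch (- m%:R) n
        * poch (ksum kappa + d.+1%:R) n)
      / (n`!%:R * poch (ksum kappa + d.+1%:R) (m + n))
      * (if n == 0%N then 1
         else (ksum kappa + d%:R + (2 * n)%:R) / (ksum kappa + d%:R + n%:R))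
      * \sum_(0 <= k < n.+1)
          (poch (- n%:R) k * poch (ksum kappa + d%:R + n%:R) k)
            / (poch (- m%:R) k * poch (- N%:R) k)
          * E_ k (natpt R alpha) (natpt R x) kappa.
Proof.
have le_n : (n <= m <= N)%N by rewrite hnm.
have le_na : (n <= mdeg alpha <= N)%N by rewrite mdeg_simplex.
set K := (X in X * \sum_(_ <= _ < _) _).
set A := ksum kappa + d.+1%:R.
have DA : A = ksum kappa + d%:R + 1 by rewrite /A -natr1 addrA.
have A_gt0 : 0 < A by apply: ksum_gt0.
have nz_poch r s : poch (A + r%:R) s != 0.
  by rewrite gt_eqF // poch_gt0 // ltr_wpDr.
have nzA s : poch A s != 0 by have := nz_poch 0%N s; rewrite addr0.
have nz_c g : pochv (shift1 kappa) g != 0.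
  by rewrite gt_eqF // pochv_gt0 // => i; apply: shift1_gt0.
have nz_fact s : s`!%:R != 0 :> R by rewrite pnatr_eq0 -lt0n fact_gt0.
(* The candidate projection of m_alpha is (c)_alpha K times the kernel; its first factor cancels the
   normalisation of Q. *)
rewrite /Q_ (@projV_eq _ _ _ _ hkappa _
  ((pochv (shift1 kappa) alpha * K) *: hahn_kernel N kappa alpha n)).
- rewrite scalerA mulKf // ffunE sum_ffunE big_mkord; congr (_ * _).
  by apply: eq_bigr => k _; rewrite ffunE kernfunE mdeg_simplex.
- exact/memvZ/hahn_kernel_Vsp.
- have lt_aN : (mdeg alpha < N.+1)%N by rewrite mdeg_simplex.
  rewrite monoE; apply: (subvP (polyspS _ _ _ lt_aN)).
  exact: mffun_polysp.
- move=> f Vf; rewrite linearBl monoE linearZl_LR /= hahn_dot_kernel_Vsp //.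
  have := hahn_dot_kernfun_Vsp hkappa le_na Vf; rewrite mdeg_simplex -/A.
  (* Both tail factors are written as quotients of the same (A)_(N + n), which then cancels. *)
  have -> : poch (A + (m + n)%:R) (N - m) = poch A (N + n) / poch A (m + n).
    have -> : (N + n = (m + n) + (N - m))%N by lia.
    by rewrite pochD mulrAC divff ?mul1r.
  have -> : poch (A + (n + n)%:R) (N - n) = poch A (N + n) / poch A (n + n).
    have -> : (N + n = (n + n) + (N - n))%N by lia.
    by rewrite pochD mulrAC divff ?mul1r.
  move=> Hdot; apply/eqP; rewrite subr_eq0; apply/eqP.
  (* The last factor is the inverse of the constant computed in [hahn_constant]. *)
  have dker : hahn_dot kappa (kernfun N kappa alpha n) f =
      hahn_dot kappa (mffun R N alpha) f / pochv (shift1 kappa) alpha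
      * (poch A (m + n) * (N - m)`!%:R / (poch A (n + n) * (N - n)`!%:R)).
    apply: (mulIf (x := poch A (N + n) / poch A (m + n) / (N - m)`!%:R)).
      by rewrite !mulf_neq0 ?invr_eq0.
    by rewrite Hdot; field; rewrite !nzA !nz_fact nz_c.
  have := hahn_constant DA A_gt0 le_n; rewrite -/K.
  set q := (X in K * X = _) => Kq.
  rewrite [RHS]mulrA -[_ * q]mulrA Kq dker.
  by field; rewrite !nzA !nz_fact nz_c.
- exact: leq_trans hmN.
Qed.
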